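(* Assume that $1<c<2$ and let $m\ge 2$ be an integer. Let $L_k$ denote the subword complexity of the sequence $(\lfloor n^c\rfloor \bmod m)_{n\ge 0}$. There exists a constant $C_1$ such that $L_k\le C_1 k^r$ for all $k\ge 1$, for all $r>\max\{4/(2-c),6\}$. Moreover, there is a constant $C_2>0$ such that $L_k\ge C_2 k^3$ for all $k\ge1$.
   Context: For a sequence $u$ with values in $\{0,1,\ldots,m-1\}$ and a positive integer $k$, the subword complexity $L_k$ is the number of distinct blocks $B\in\{0,\ldots,m-1\}^k$ that occur as a contiguous subsequence $(u_n,u_{n+1},\ldots,u_{n+k-1})$ of $u$. *)

(* Defs.v *)
From HB Require Import structures.
From mathcomp Require Import all_boot all_order all_algebra.
From mathcomp Require Import boolp classical_sets reals exp.
Set Implicit Arguments. Unset Strict Implicit. Unset Printing Implicit Defensive.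
Import Order.TTheory GRing.Theory Num.Theory.

Definition subword_complexity (m : nat) (u : nat -> nat) (k : nat) : nat :=
  #| [set B : {ffun 'I_k -> 'I_m} |
       `[< exists n : nat, forall i : 'I_k, val (B i) = u (n + val i) >] ] |.

Local Open Scope ring_scope.

(* The sequence (floor(n^c) mod m)_{n >= 0}; n^c >= 0 so truncn is the floor,
   and powR gives 0 `^ c = 0 for c <> 0. *)
Definition floor_pow_mod (R : realType) (c : R) (m : nat) (n : nat) : nat :=
  (Num.truncn ((n%:R : R) `^ c) %% m)%N.

(* Main.v *)
(** Upper bound. For n >= (2 k^3)^(1/(2-c)) the sequence g i = (n+i)^c, i < k, is
    convex and so close to affine that (y - x)(g z - g y) exceeds
    (z - y)(g y - g x) by at most 1 whenever x < y < z. Lower g until it touches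
    a lattice point at some i1. On either side of i1 the floors u d, at distance
    d from i1, are then determined by the first maximiser e of u d / d and the
    value u e, and modulo m only u e mod (m e) matters. This leaves O(k^5)
    words; smaller n contribute at most one word each.

    Lower bound. For a rational slope p/q and any a, some n makes the word at n
    equal to that of the line (a + i p)/q: far out there are arbitrarily long
    windows on which the derivative of x^c stays in [b + rho/2, b + rho] modulo
    m, b = p/q; sampling such a window with step m q, the values move modulo m
    upwards by small steps through a whole period, so one of them falls just
    above a/q. Distinct triples (p, q, a) with p/q reduced, p, a < q <= k/2 give
    distinct words, and the sum of q phi(q) over q <= K is at least K^3/64. *)

Require Import Defs.
From HB Require Import structures.
From mathcomp Require Import all_boot all_order all_algebra.
From mathcomp Require Import boolp classical_sets reals exp.
From mathcomp Require Import normedtype derive cyclic zify ring lra.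
Set Implicit Arguments.
Unset Strict Implicit.
Unset Printing Implicit Defensive.
Import Order.TTheory GRing.Theory Num.Theory numFieldNormedType.Exports.
Local Open Scope ring_scope.

(** * Chords and derivatives of real powers *)

Lemma powR_MVT (R : realType) (a x y : R) : 0 < x -> x <= y ->
  exists2 z, x <= z <= y & y `^ a - x `^ a = a * z `^ (a - 1) * (y - x).
Proof.
move=> x0 xy.
have dpow (z : R) : x <= z -> is_derive z 1 (@powR R ^~ a) (a * z `^ (a - 1)).
  by move=> xz; apply: is_derive1_powR; apply: lt_le_trans xz.
have [||z] := @MVT_segment R (@powR R ^~ a) (fun z => a * z `^ (a - 1)) _ _ xy.
- by move=> z /[!in_itv]/= /andP[xz _]; apply: dpow; exact: ltW.
- apply: derivable_within_continuous => z /[!in_itv]/= /andP[xz _].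
  by apply: ex_derive; exact: dpow.
- by rewrite in_itv /= => xzy ?; exists z.
Qed.

Lemma powR_slope (R : realType) (c x y : R) : 1 <= c -> 0 < x -> x <= y ->
  c * x `^ (c - 1) * (y - x) <= y `^ c - x `^ c <= c * y `^ (c - 1) * (y - x).
Proof.
move=> c1 x0 xy; have [z /andP[xz zy] ->] := powR_MVT c x0 xy.
have z0 := lt_le_trans x0 xz; have y0 := lt_le_trans x0 xy.
by rewrite !ler_wpM2r ?subr_ge0 // ler_wpM2l ?ge0_ler_powR ?nnegrE ?subr_ge0 //;
  lra.
Qed.

Lemma powR_npos_le (R : realType) (a x y : R) : a <= 0 -> 0 < x -> x <= y ->
  y `^ a <= x `^ a.
Proof.
move=> a0 x0 xy; have y0 := lt_le_trans x0 xy.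
rewrite -[a]opprK (powRN x) (powRN y) lef_pV2 ?posrE ?powR_gt0 //.
by rewrite ge0_ler_powR ?nnegrE ?oppr_ge0 // ltW.
Qed.

(** The mean value theorem for the exponent c - 1; the factor 2 bounds c (c - 1). *)
Lemma powR_slope_lip (R : realType) (c x y : R) : 1 <= c -> c <= 2 ->
  0 < x -> x <= y ->
  0 <= c * y `^ (c - 1) - c * x `^ (c - 1) <= 2 * x `^ (c - 2) * (y - x).
Proof.
move=> c1 c2 x0 xy; rewrite -mulrBr.
have [z /andP[xz zy] ->] := powR_MVT (c - 1) x0 xy.
have -> : c - 1 - 1 = c - 2 by lra.
have zx : z `^ (c - 2) <= x `^ (c - 2) by apply: powR_npos_le => //; lra.
have := powR_ge0 z (c - 2).
set u := z `^ _ in zx *; set v := x `^ _ in zx * => u0.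
apply/andP; split; first by rewrite !mulr_ge0 //; lra.
rewrite !mulrA ler_wpM2r ?subr_ge0 //.
apply: (@le_trans _ _ (2 * 1 * u)); last by rewrite mulr1 ler_wpM2l.
by rewrite ler_wpM2r // ler_pM //; lra.
Qed.

(** The derivative at y separates the two chord slopes, and the derivatives at x and z enclose them;
    so the slopes are ordered and differ by at most the growth of the derivative over [x, z]. *)
Lemma powR_cross (R : realType) (c b x y z : R) : 1 <= c -> c <= 2 ->
  0 < b -> b <= x -> x <= y -> y <= z ->
  0 <= (y - x) * (z `^ c - y `^ c) - (z - y) * (y `^ c - x `^ c)
    <= (y - x) * (z - y) * (2 * b `^ (c - 2) * (z - x)).
Proof.
move=> c1 c2 b0 bx xy yz.
have x0 := lt_le_trans b0 bx; have y0 := lt_le_trans x0 xy.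
have z0 := lt_le_trans y0 yz.
have /andP[l1 u1] := powR_slope c1 x0 xy.
have /andP[l2 u2] := powR_slope c1 y0 yz.
have /andP[_] := powR_slope_lip c1 c2 x0 (le_trans xy yz).
have bb : x `^ (c - 2) <= b `^ (c - 2) by apply: powR_npos_le => //; lra.
have d0 : 0 <= y - x by rewrite subr_ge0.
have d1 : 0 <= z - y by rewrite subr_ge0.
have bzx : 2 * x `^ (c - 2) * (z - x) <= 2 * b `^ (c - 2) * (z - x).
  by rewrite ler_wpM2r ?ler_wpM2l //; lra.
move=> /le_trans/(_ bzx)/(ler_wpM2l (mulr_ge0 d0 d1)) bde.
move: (ler_wpM2l d1 l1) (ler_wpM2l d1 u1) (ler_wpM2l d0 l2) (ler_wpM2l d0 u2).
lra.
Qed.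

(** * Integer parts of rational lines *)

Lemma progression_dvdn (p q a x : nat) : (0 < q)%N -> coprime q p ->
  exists2 i, (x <= i < x + q)%N & (q %| a + i * p)%N.
Proof.
move=> q0 /eqP qp; have [u _] := Bezoutl p q0; rewrite qp => qu.
(* Since [u] inverts -p modulo q, the value here is congruent to (1 + u p)(a + x p). *)
exists (x + (u * (a + x * p)) %% q)%N.
  by rewrite leq_addr ltn_add2l ltn_mod.
rewrite mulnDl addnA /dvdn -modnDmr modnMml modnDmr.
rewrite (_ : _ + _ = (1 + u * p) * (a + x * p))%N; last by ring.
exact: dvdn_mulr.
Qed.

(** At a lattice point the first line equals its integer part, which the second line shares and so
    cannot be below. *)
Lemma floor_line_touch (p q a p' q' a' i : nat) :
  ((a + i * p) %/ q = (a' + i * p') %/ q')%N -> (q %| a + i * p)%N ->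
  (q' * (a + i * p) <= q * (a' + i * p'))%N.
Proof.
move=> E /divnK eq; rewrite -eq E mulnC -mulnA mulnCA leq_mul2l.
by rewrite leq_divM orbT.
Qed.

(* Each line meets a lattice point in every window of length K, so neither
   line can lie above the other on both windows unless they coincide. *)
Lemma floor_line_inj (K p q a p' q' a' : nat) :
  (a < q)%N -> (a' < q')%N -> (q <= K)%N -> (q' <= K)%N ->
  coprime q p -> coprime q' p' ->
  (forall i, (i < 2 * K)%N -> ((a + i * p) %/ q = (a' + i * p') %/ q')%N) ->
  [/\ p = p', q = q' & a = a'].
Proof.
move=> aq aq' qK qK' cop cop' E.
have q0 : (0 < q)%N by exact: leq_ltn_trans aq.
have q'0 : (0 < q')%N by exact: leq_ltn_trans aq'.
have touch x : (x <= K)%N -> exists2 i, (x <= i < x + K)%N &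
    (q' * (a + i * p) <= q * (a' + i * p'))%N.
  move=> xK; have [i xi qi] := progression_dvdn a x q0 cop.
  by exists i; [lia | apply: floor_line_touch => //; apply: E; lia].
have touch' x : (x <= K)%N -> exists2 i, (x <= i < x + K)%N &
    (q * (a' + i * p') <= q' * (a + i * p))%N.
  move=> xK; have [i xi qi] := progression_dvdn a' x q'0 cop'.
  by exists i; [lia | apply: floor_line_touch => //; rewrite -E //; lia].
(* Each inequality between the lines holds at some point before K and at some point from K on.
   Pairing opposite windows orders the slopes both ways; equal slopes then leave only the
   intercepts. *)
have [i0 ri0 hi0] := touch 0%N isT; have [i1 ri1 hi1] := touch K (leqnn K).
have [j0 rj0 hj0] := touch' 0%N isT; have [j1 rj1 hj1] := touch' K (leqnn K).
have slope : (q * p' = q' * p)%N.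
  move: hi0 hi1 hj0 hj1; rewrite !mulnDr !(mulnCA q) !(mulnCA q').
  have mono X Y A B i j : (i < j)%N -> (B + i * Y <= A + i * X)%N ->
      (A + j * X <= B + j * Y)%N -> (X <= Y)%N.
    move=> ij h1 h2; rewrite -(@leq_pmul2l (j - i)) ?subn_gt0 // !mulnBl.
    have := leq_mul (ltnW ij) (leqnn X); have := leq_mul (ltnW ij) (leqnn Y).
    lia.
  move=> h1 h2 h3 h4; apply/eqP; rewrite eqn_leq; apply/andP; split.
    by apply: mono h1 h4; lia.
  by apply: mono h3 h2; lia.
have eqq : q = q'.
  apply/eqP; rewrite eqn_dvd; apply/andP; split.
    by rewrite -(Gauss_dvdl q' cop) -slope dvdn_mulr.
  by rewrite -(Gauss_dvdl q cop') slope dvdn_mulr.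
subst q'; have eqp : p = p' by apply/eqP; rewrite -(eqn_pmul2l q0) slope.
subst p'; split => //; move: hi0 hj0; rewrite !leq_pmul2l // !leq_add2r.
by move=> aa' a'a; apply/eqP; rewrite eqn_leq aa'.
Qed.

Lemma floor_lineS (p q a i : nat) : (p < q)%N ->
  ((a + i * p) %/ q <= (a + i.+1 * p) %/ q <= ((a + i * p) %/ q).+1)%N.
Proof.
move=> pq; have q0 : (0 < q)%N by exact: leq_ltn_trans pq.
rewrite leq_div2r ?leq_add2l ?leq_mul2r ?leqnSn ?orbT //=.
apply: (@leq_trans ((a + i * p + q) %/ q)); last by rewrite divnDr // divnn q0 addn1.
by apply: leq_div2r; lia.
Qed.

(** Both integer parts start at 0 and grow by 0 or 1 at each step, and m >= 2 tells these increments
    apart. *)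
Lemma floor_line_mod_eq (m k p q a p' q' a' : nat) :
  (2 <= m)%N -> (a < q)%N -> (a' < q')%N -> (p < q)%N -> (p' < q')%N ->
  (forall i, (i < k)%N -> (a + i * p) %/ q = (a' + i * p') %/ q' %[mod m])%N ->
  forall i, (i < k)%N -> ((a + i * p) %/ q = (a' + i * p') %/ q')%N.
Proof.
move=> m2 aq aq' pq pq' E; elim=> [|i IH] ik.
  by rewrite !mul0n !addn0 !divn_small.
have := E _ ik; have := floor_lineS a i pq; have := floor_lineS a' i pq'.
rewrite (IH (ltnW ik)).
move: ((a' + i * p') %/ q')%N ((a + i.+1 * p) %/ q)%N ((a' + i.+1 * p') %/ q')%N.
move=> s t t' h h' tt'.
have [||//] := ltngtP t t'.
  move=> lt; have : (t' = t + 1)%N by lia.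
  by move=> eq; move/eqP: tt'; rewrite eq -{1}[t]addn0 eqn_modDl !modn_small //; lia.
move=> lt; have : (t = t' + 1)%N by lia.
by move=> eq; move/eqP: tt'; rewrite eq -{2}[t']addn0 eqn_modDl !modn_small //; lia.
Qed.

(** * Sums of totients *)

(** Passing from K to K + 1 raises the quotient by d exactly when d divides K + 1, and the totients
    of the divisors of K + 1 add up to K + 1. *)
Lemma sum_totient_divn (K : nat) :
  (2 * \sum_(d < K.+1) totient d * (K %/ d) = K * K.+1)%N.
Proof.
elim: K => [|K IH]; first by rewrite big_ord1.
rewrite big_ord_recr /= divnn /= muln1.
rewrite (eq_bigr (fun d : 'I_K.+1 =>
  (if (d %| K.+1)%N then totient d else 0) + totient d * (K %/ d))%N).
  rewrite big_split /= -big_mkcond /= addnAC mulnDr IH.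
  have := sum_totient_dvd K.+1.
  by rewrite big_mkcond big_ord_recr /= dvdnn -big_mkcond => ->; ring.
move=> [[|d] dK] _ //=.
by rewrite divnS // mulnDr; case: (_ %| _)%N; rewrite ?muln1 ?muln0.
Qed.

(** In the preceding identity the terms with d <= K/4 are at most K each, hence K^2/4 in all; for
    larger d the quotient is below 4 and K < 4 d, so K times the term is at most 16 d
    [totient d]. *)
Lemma sum_mul_totient_ge (K : nat) :
  (K ^ 3 <= 64 * \sum_(d < K.+1) d * totient d)%N.
Proof.
have small n : (4 * \sum_(d < n) (4 * d.+1 <= K) <= K)%N.
  have : (\sum_(d < n) (4 * d.+1 <= K) <= minn n (K %/ 4))%N.
    elim: n => [|n IH]; rewrite ?big_ord0 // big_ord_recr /=.
    by move: IH; case: (leqP (4 * n.+1)) => /=; lia.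
  have := leq_divM K 4; lia.
have term (d : nat) : (K * (totient d * (K %/ d)) <=
    K * K * ((0 < d) && (4 * d <= K)) + 16 * (d * totient d))%N.
  case: d => [|d]; first by rewrite divn0 !muln0.
  have phi_le : (totient d.+1 <= d.+1)%N.
    rewrite totient_count_coprime big_mkord -[X in (_ <= X)%N]card_ord -sum1_card.
    by apply: leq_sum => i _; case: coprime.
  have divK : (d.+1 * (K %/ d.+1) <= K)%N by rewrite mulnC leq_divM.
  have [dK|dK] := leqP (4 * d.+1) K; rewrite /=.
    rewrite muln1; apply: leq_trans (leq_addr _ _).
    by rewrite leq_mul2l (leq_trans _ divK) ?orbT // leq_mul2r phi_le orbT.
  rewrite muln0 add0n.
  have : (K * (K %/ d.+1) <= 16 * d.+1)%N.
    have : (K %/ d.+1 < 4)%N by rewrite ltn_divLR //; lia.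
    by rewrite ltnS => /(leq_mul (leqnn K)); lia.
  by move=> h; rewrite mulnCA (mulnA 16) (mulnC _ (totient _)) leq_mul2l h orbT.
have := sum_totient_divn K.
have : (K * \sum_(d < K.+1) totient d * (K %/ d) <=
   K * K * \sum_(d < K) (4 * d.+1 <= K) + 16 * \sum_(d < K.+1) d * totient d)%N.
  rewrite [in X in (_ <= X + _)%N](_ : \sum_(d < K) _ =
      \sum_(d < K.+1) ((0 < d) && (4 * d <= K)))%N; last by rewrite big_ord_recl.
  rewrite !big_distrr -big_split /=.
  by apply: leq_sum => d _; apply: term.
have := small K.
move: (\sum_(d < K) _)%N (\sum_(d < K.+1) d * _)%N (\sum_(d < K.+1) _)%N.
by move=> s S T; rewrite !expnS expn0; nia.
Qed.

(** * Counting line words *)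

Lemma card_Farey_triples (K : nat) :
  #|[set x : 'I_K.+1 * ('I_K.+1 * 'I_K.+1) |
      [&& (x.2.1 < x.1)%N, coprime x.1 x.2.1 & (x.2.2 < x.1)%N]]|
  = (\sum_(q < K.+1) q * totient q)%N.
Proof.
rewrite -sum1_card big_mkcond /=.
transitivity (\sum_(q < K.+1) \sum_(p < K.+1) \sum_(a < K.+1)
    ((a < q) * ((p < q) && coprime q p)))%N.
  under [RHS]eq_bigr do rewrite pair_bigA.
  rewrite pair_bigA; apply: eq_bigr => -[q [p a]] _ /=.
  by rewrite inE /=; do 3!case: (_ < _)%N => //=; case: coprime.
apply: eq_bigr => q _.
under eq_bigr do rewrite -big_distrl /=.
rewrite -big_distrr /=; congr (_ * _)%N.
  rewrite -big_mkcond /= -(big_ord_widen K.+1 (fun=> 1%N)) 1?ltnW //.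
  by rewrite sum1_card card_ord.
rewrite totient_count_coprime big_mkord.
rewrite (big_ord_widen K.+1 (fun p => coprime q p : nat)) 1?ltnW //.
by rewrite [RHS]big_mkcond; apply: eq_bigr => p _; case: ltnP.
Qed.

Lemma subword_complexity_ge (m k K : nat) (u : nat -> nat) :
  (2 <= m)%N -> (2 * K <= k)%N ->
  (forall p q a, (p < q)%N -> exists n, forall i, (i < k)%N ->
     u (n + i)%N = ((a + i * p) %/ q %% m)%N) ->
  (\sum_(q < K.+1) q * totient q <= subword_complexity m u k)%N.
Proof.
move=> m2 Kk occ; rewrite -card_Farey_triples /subword_complexity.
have m0 : (0 < m)%N by exact: leq_trans m2.
pose w (x : 'I_K.+1 * ('I_K.+1 * 'I_K.+1)) : {ffun 'I_k -> 'I_m} :=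
  [ffun i : 'I_k => Ordinal (ltn_pmod ((x.2.2 + i * x.2.1) %/ x.1) m0)].
rewrite -(card_in_imset (f := w)).
  apply/subset_leq_card/fintype.subsetP => _ /imsetP[x /[!inE]/and3P[px cx ax] ->].
  have [n hn] := occ _ _ x.2.2 px.
  by exists n => i; rewrite ffunE /= hn.
move=> [q [p a]] [q' [p' a']] /[!inE]/= /and3P[pq cop aq] /and3P[pq' cop' aq'] E.
have Em i : (i < k)%N -> ((a + i * p) %/ q = (a' + i * p') %/ q' %[mod m])%N.
  by move=> ik; move/ffunP/(_ (Ordinal ik)): E; rewrite !ffunE => -[].
have Ei := floor_line_mod_eq m2 aq aq' pq pq' Em.
have [||i ik|ep eq ea] := floor_line_inj (K := K) aq aq' _ _ cop cop'.
- by rewrite -ltnS.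
- by rewrite -ltnS.
- by apply: Ei; exact: leq_trans Kk.
- by congr (_, (_, _)); exact: val_inj.
Qed.

Lemma subword_complexity_gt0 (m k : nat) (u : nat -> nat) :
  (forall n, u n < m)%N -> (0 < subword_complexity m u k)%N.
Proof.
move=> um; apply/card_gt0P; exists [ffun i : 'I_k => Ordinal (um i)].
by rewrite inE; apply/asboolP; exists 0%N => i; rewrite ffunE.
Qed.

(** * Occurrence of line words in the sequence *)

(** The derivative of x^c is unbounded, but it varies ever more slowly: [x0] is where it equals m M
    + b + rho/2, and M is taken so large that it gains at most rho/2 over a length W. *)
Lemma powR_slope_window (R : realType) (c b rho W : R) (m : nat) :
  1 < c -> c < 2 -> 0 <= b -> 0 < rho -> 0 <= W -> (0 < m)%N ->
  exists M : nat, exists2 x0 : R, 0 < x0 &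
    forall x y, x0 <= x -> x <= y -> y <= x0 + W ->
    ((m * M)%:R + b) * (y - x) + rho / 2 * (y - x) <= y `^ c - x `^ c
      <= ((m * M)%:R + b) * (y - x) + rho * (y - x).
Proof.
move=> c1 c2 b0 rho0 W0 m0.
have c0 : 0 < c by lra.
have A1 : 1 <= 4 * W / rho + 1 by rewrite lerDr divr_ge0 ?mulr_ge0 // ltW.
have A0 : 0 < 4 * W / rho + 1 by exact: lt_le_trans A1.
(* From X on, the Lipschitz bound 2 X^(c-2) W is at most rho/2; the added 1 keeps X positive when W
   = 0. *)
pose X := (4 * W / rho + 1) `^ (2 - c)^-1.
have X0 : 0 < X by exact: powR_gt0.
have Xc : 4 * W * X `^ (c - 2) <= rho.
  rewrite -[c - 2]opprB powRN /X -powRrM mulVf ?gt_eqF ?subr_gt0 //.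
  rewrite powRr1; last exact: ltW.
  rewrite ler_pdivrMr // mulrDr mulr1 (mulrC rho) divfK ?gt_eqF //.
  by rewrite lerDl ltW.
(* M exceeds the derivative at X, which forces [x0] to lie beyond X. *)
clearbody X; pose M := (Num.truncn (c * X `^ (c - 1))).+1.
have MX : c * X `^ (c - 1) < M%:R by exact: truncnS_gt.
clearbody M; have mM : M%:R <= (m * M)%:R :> R by rewrite ler_nat leq_pmull.
pose v := (m * M)%:R + b + rho / 2.
have v0 : 0 < v by have := ler0n R (m * M); rewrite /v; lra.
pose x0 := (v / c) `^ (c - 1)^-1.
have x00 : 0 < x0 by apply: powR_gt0; exact: divr_gt0.
have x0v : c * x0 `^ (c - 1) = v.
  rewrite /x0 -powRrM mulVf ?gt_eqF ?subr_gt0 // powRr1.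
    by rewrite mulrC divfK // gt_eqF.
  by rewrite divr_ge0 // ltW.
clearbody x0; have Xx0 : X <= x0.
  rewrite leNgt; apply/negP => x0X.
  have : x0 `^ (c - 1) <= X `^ (c - 1).
    by rewrite ge0_ler_powR ?nnegrE ?subr_ge0 // ltW.
  by move/(ler_wpM2l (ltW c0)); rewrite x0v /v; lra.
exists M, x0 => // x y x0x xy yW.
have xp : 0 < x by exact: lt_le_trans x0x.
have x0y := le_trans x0x xy.
have /andP[l u] := powR_slope (ltW c1) xp xy.
have /andP[l1 _] := powR_slope_lip (ltW c1) (ltW c2) x00 x0x.
have /andP[_ u2] := powR_slope_lip (ltW c1) (ltW c2) x00 x0y.
have : 2 * x0 `^ (c - 2) * (y - x0) <= 2 * X `^ (c - 2) * W.
  by rewrite ler_pM ?mulr_ge0 ?powR_ge0 ?subr_ge0 ?ler_wpM2l ?powR_npos_le //;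
    lra.
move: l1 u2; rewrite x0v => l1 u2 h.
have yx : 0 <= y - x by rewrite subr_ge0.
have sl : v <= c * x `^ (c - 1) by lra.
have su : c * y `^ (c - 1) <= (m * M)%:R + b + rho by move: u2; rewrite /v; lra.
have := le_trans (ler_wpM2r yx sl) l; have := le_trans u (ler_wpM2r yx su).
by rewrite /v; lra.
Qed.

Lemma floor_powR_line_occurs (R : realType) (c : R) (m k p q a : nat) :
  1 < c -> c < 2 -> (0 < m)%N -> (p < q)%N ->
  exists n, forall i, (i < k)%N ->
    floor_pow_mod c m (n + i) = ((a + i * p) %/ q %% m)%N.
Proof.
move=> c1 c2 m0 pq; have q0 : (0 < q)%N by exact: leq_ltn_trans pq.
have qR : 0 < q%:R :> R by rewrite ltr0n.
have mR : 0 < m%:R :> R by rewrite ltr0n.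
(* The step Q makes Q b = m p a multiple of m. *)
pose Q := (m * q)%N; pose b : R := p%:R / q%:R.
have QR : 0 < Q%:R :> R by rewrite ltr0n muln_gt0 m0.
(* The drift over Q + k indices stays below 1/q. *)
pose rho : R := (q%:R * (k + Q).+1%:R)^-1.
have rho0 : 0 < rho by rewrite invr_gt0 mulr_gt0.
have rhoq : (k%:R + Q%:R) * rho < q%:R^-1.
  rewrite /rho invfM mulrCA -ltr_pdivlMl ?invr_gt0 // mulVf ?gt_eqF ?invr_gt0 //.
  by rewrite ltr_pdivrMr // mul1r -natrD ltr_nat.
(* J steps of length Q drift upwards by at least m in total. *)
pose J := (Num.truncn (2 * m%:R / (Q%:R * rho))).+1.
have hJ : m%:R <= rho / 2 * (J * Q)%:R.
  have : 2 * m%:R / (Q%:R * rho) < J%:R by exact: truncnS_gt.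
  by rewrite ltr_pdivrMr ?mulr_gt0 // natrM; lra.
have b0 : 0 <= b by rewrite divr_ge0.
have [M [x0 x00 win]] :=
  powR_slope_window c1 c2 b0 rho0 (ler0n R (1 + J * Q + k)) m0.
pose n0 := (Num.truncn x0).+1.
have n0x : x0 <= n0%:R by exact/ltW/truncnS_gt.
have n0x1 : n0%:R <= x0 + 1.
  by rewrite -natr1 lerD2r truncn_le ltW.
have incr (u v : nat) : (u <= v)%N -> (v <= J * Q + k)%N ->
    ((m * M)%:R + b) * (v - u)%:R + rho / 2 * (v - u)%:R <=
      (n0 + v)%:R `^ c - (n0 + u)%:R `^ c <=
    ((m * M)%:R + b) * (v - u)%:R + rho * (v - u)%:R.
  move=> uv vJ; have := win (n0 + u)%:R (n0 + v)%:R.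
  rewrite (_ : (n0 + v)%:R - (n0 + u)%:R = (v - u)%:R); last first.
    by rewrite natrB // !natrD; ring.
  apply.
  - by rewrite natrD ler_wpDr.
  - by rewrite ler_nat leq_add2l.
  - have : v%:R <= (J * Q + k)%:R :> R by rewrite ler_nat.
    by rewrite !natrD; lra.
have Qb : Q%:R * b = (m * p)%:R.
  by rewrite /Q /b !natrM; field; rewrite gt_eqF.
(* The integer removed is a multiple of m, so [h] records the drift alone. *)
pose h j : R := (n0 + j * Q)%:R `^ c - (j * (Q * (m * M) + m * p))%:R.
have hE j : (j * (Q * (m * M) + m * p))%:R = ((m * M)%:R + b) * (j * Q)%:R.
  by rewrite !natrM natrD -Qb !natrM; ring.
have hS j : (j < J)%N -> h j.+1 <= h j + Q%:R * rho.
  move=> jJ; have jj : (j * Q <= j.+1 * Q)%N by rewrite leq_mul2r leqnSn orbT.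
  have jJk : (j.+1 * Q <= J * Q + k)%N.
    by rewrite (leq_trans _ (leq_addr _ _)) // leq_mul2r jJ orbT.
  have /andP[_] := incr _ _ jj jJk.
  rewrite /h !hE (_ : j.+1 * Q - j * Q = Q)%N; last by rewrite mulSn addnK.
  rewrite (_ : (j.+1 * Q)%:R = (j * Q)%:R + Q%:R :> R); last first.
    by rewrite mulSn addnC natrD.
  by lra.
have h0J : h 0%N + m%:R <= h J.
  have /andP[+ _] := incr 0%N (J * Q)%N isT (leq_addr _ _).
  by rewrite /h !hE mul0n !addn0 subn0 mulr0 subr0; lra.
(* T is the least number a/q + m Z that is not below [h 0]; the drift passes it by J, and its first
   crossing overshoots by at most Q rho. *)
pose Z := Num.ceil ((h 0%N - a%:R / q%:R) / m%:R).
pose T : R := m%:R * Z%:~R + a%:R / q%:R.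
have hT : h 0%N <= T.
  have := ceil_ge ((h 0%N - a%:R / q%:R) / m%:R).
  by rewrite -/Z ler_pdivrMr // /T; lra.
have TJ : T <= h J.
  have := ceilB1_lt ((h 0%N - a%:R / q%:R) / m%:R).
  by rewrite -/Z ltr_pdivlMr // /T; lra.
have exT : exists j, T <= h j by exists J.
case: (ex_minnP exT) => j Tj jmin.
have jJ : (j <= J)%N by exact: jmin.
have jT : h j <= T + Q%:R * rho.
  case: j Tj jmin jJ => [|j] Tj jmin jJ.
    by rewrite (le_trans hT) // lerDl mulr_ge0 // ltW.
  apply: le_trans (hS _ jJ) _; rewrite lerD2r leNgt; apply/negP => /ltW /jmin.
  by rewrite ltnn.
exists (n0 + j * Q)%N => i ik.
have jQi : (j * Q + i <= J * Q + k)%N by rewrite leq_add ?leq_mul // ltnW.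
have /andP[] := incr _ _ (leq_addr i (j * Q)) jQi.
rewrite addKn addnA => l u.
set s := ((a + i * p) %/ q)%N.
pose z : int := Z + (j * (Q * M + p) + i * M)%:Z.
have fl : Num.floor ((n0 + j * Q + i)%:R `^ c : R) = z * m%:Z + s%:Z.
  apply: floor_def.
  have zE : (z * m%:Z + s%:Z)%:~R = m%:R * Z%:~R +
      (j * (Q * (m * M) + m * p))%:R + (m * M)%:R * i%:R + s%:R :> R.
    by rewrite /z !(intrD, intrM) -!pmulrn !(natrD, natrM); ring.
  have sE : a%:R / q%:R + b * i%:R = s%:R + ((a + i * p) %% q)%:R / q%:R :> R.
    have := congr1 (GRing.natmul (1 : R)) (divn_eq (a + i * p) q).
    rewrite -/s /b !natrD !natrM => E.
    rewrite (_ : _ + _ = (a%:R + i%:R * p%:R) / q%:R); last by ring.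
    by rewrite E mulrDl mulfK // gt_eqF.
  have r0 : 0 <= ((a + i * p) %% q)%:R / q%:R :> R by rewrite divr_ge0.
  (* The line stays at least 1/q below the next integer, which leaves room for the overshoot Q rho
     and the drift k rho. *)
  have r1 : ((a + i * p) %% q)%:R / q%:R + q%:R^-1 <= 1 :> R.
    rewrite -[X in _ + X]mul1r -mulrDl ler_pdivrMr // mul1r natr1 ler_nat.
    by rewrite ltn_mod.
  have ik' : rho * i%:R <= rho * k%:R.
    by apply: ler_wpM2l; [exact: ltW | rewrite ler_nat ltnW].
  have i0 : 0 <= rho * i%:R by rewrite mulr_ge0 // ltW.
  rewrite [X in _ < X]intrD zE; move: Tj jT; rewrite /T /h.
  by move: l u rhoq; lra.
rewrite /floor_pow_mod; apply/eqP; rewrite -eqz_nat -!modz_nat.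
by rewrite truncn_floor powR_ge0 gez0_abs ?floor_ge0 ?powR_ge0 // fl modzMDl.
Qed.

(** * Coding almost affine convex words *)

Lemma exists_first_max_slope (u : nat -> int) (D : nat) : (0 < D)%N ->
  exists2 e, (0 < e <= D)%N & forall d, (0 < d <= D)%N ->
    u d * e%:Z <= u e * d%:Z /\ ((d < e)%N -> u d * e%:Z < u e * d%:Z).
Proof.
elim: D => [//|D IH] _; have [->|D0] := posnP D.
  by exists 1%N => // d d1; have -> : d = 1%N by lia.
have [e eD emax] := IH D0.
have e0 : 0 < e%:Z by lia.
have [le|lt] := lerP (u D.+1 * e%:Z) (u e * D.+1%:Z).
  exists e => [|d dD]; first by lia.
  have [->|dD'] : d = D.+1 \/ (d <= D)%N by lia.
    by split => // ?; lia.
  by apply: emax; lia.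
exists D.+1; first by rewrite leqnn.
move=> d dD; have [->|dD'] : d = D.+1 \/ (d <= D)%N by lia.
  by split => // ?; lia.
suff lt' : u d * D.+1%:Z < u D.+1 * d%:Z by split => [|_//]; exact: ltW.
have [|le _] := emax d; first by lia.
have d0 : 0 < d%:Z by lia.
rewrite -(ltr_pM2r e0).
apply: (@le_lt_trans _ _ (u e * d%:Z * D.+1%:Z)).
  by rewrite mulrAC ler_wpM2r.
by rewrite mulrAC [X in _ < X]mulrAC ltr_pM2r.
Qed.

(* Before the first maximiser e of u d / d the maximum is not attained, which
   is why the numerator is lowered by one there: it turns the floor of
   d * u e / e into its strict lower integer part. *)
Lemma floor_convex_recover (R : realType) (h : nat -> R) (u : nat -> int)
    (D : nat) : (0 < D)%N ->
  (forall d, (0 < d <= D)%N -> (u d)%:~R <= h d < (u d)%:~R + 1) ->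
  (forall d d', (0 < d)%N -> (d < d')%N -> (d' <= D)%N ->
     0 <= d%:R * h d' - d'%:R * h d <= 1) ->
  exists2 e, (0 < e <= D)%N & forall d, (0 < d <= D)%N ->
    u d = ((d%:Z * u e - (d < e)%N%:Z) %/ e%:Z)%Z.
Proof.
move=> D0 fl cross; have [e eD emax] := exists_first_max_slope u D0.
exists e => // d dD; have [le lt] := emax d dD.
have /andP[fd1 fd2] := fl d dD; have /andP[fe1 fe2] := fl e eD.
have e0 : 0 < e%:Z by lia.
have dR : 0 <= d%:R :> R by [].
have eR : 0 < e%:R :> R by rewrite ltr0n; lia.
(* For d < e the closeness to affine costs at most 1, which the lowered numerator absorbs; for d > e
   convexity costs nothing. *)
have up : d%:Z * u e - (d < e)%N%:Z < (u d + 1) * e%:Z.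
  rewrite -(ltr_int R) !(intrB, intrM, intrD) -!pmulrn.
  have H1 := ler_wpM2l dR fe1.
  have H2 : e%:R * h d < e%:R * ((u d)%:~R + 1) by rewrite ltr_pM2l.
  case: (ltngtP d e) => de /=.
  - by have /andP[_] := cross d e (proj1 (andP dD)) de (proj2 (andP eD)); lra.
  - by have /andP[+ _] := cross e d (proj1 (andP eD)) de (proj2 (andP dD)); lra.
  - by move: H1 H2; rewrite -de; lra.
apply/le_anti/andP; split.
  rewrite lez_divRL //; case: (ltnP d e) => de /=; last by lia.
  by have := lt de; lia.
by rewrite -ltzD1 ltz_divLR.
Qed.

(** The natural number [v] stands for [u e] reduced modulo m e, so that it ranges over a finite
    type. *)
Definition slope_word (e v d : nat) : int :=
  ((d%:Z * v%:Z - (d < e)%N%:Z) %/ e%:Z)%Z.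

(** Adding m e to [u e] adds d m to the quotient at d, so only the residue of [u e] modulo m e, a
    number below m k, matters modulo m. *)
Lemma slope_word_code (R : realType) (h : nat -> R) (u : nat -> int)
    (m k D : nat) : (0 < m)%N -> (D < k)%N ->
  (forall d, (0 < d <= D)%N -> (u d)%:~R <= h d < (u d)%:~R + 1) ->
  (forall d d', (0 < d)%N -> (d < d')%N -> (d' <= D)%N ->
     0 <= d%:R * h d' - d'%:R * h d <= 1) ->
  exists ev : 'I_k * 'I_(m * k), forall d, (0 < d <= D)%N ->
    (u d = slope_word ev.1 ev.2 d %[mod m])%Z.
Proof.
move=> m0 Dk fl cross; have k0 : (0 < k)%N by exact: leq_ltn_trans Dk.
have mk0 : (0 < m * k)%N by rewrite muln_gt0 m0.
have [D0|D0] := posnP D.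
  by exists (Ordinal k0, Ordinal mk0) => d; rewrite D0; lia.
have [e eD ue] := floor_convex_recover D0 fl cross.
have ek : (e < k)%N by lia.
have me0 : 0 < (m * e)%N%:Z by rewrite ltz_nat muln_gt0 m0; lia.
have v0 : 0 <= (u e %% (m * e)%N%:Z)%Z by rewrite modz_ge0 // gt_eqF.
have vE : (`|(u e %% (m * e)%N%:Z)%Z|%N)%:Z = (u e %% (m * e)%N%:Z)%Z.
  by rewrite gez0_abs.
have vlt : (`|(u e %% (m * e)%N%:Z)%Z| < m * k)%N.
  rewrite -ltz_nat vE; apply: lt_le_trans (ltz_pmod _ me0) _.
  by rewrite lez_nat leq_mul2l ltnW ?orbT.
exists (Ordinal ek, Ordinal vlt) => d dD; rewrite ue // /slope_word /= vE.
rewrite {1}(divz_eq (u e) (m * e)%N%:Z).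
set x := (u e %/ _)%Z; set v := (u e %% _)%Z.
have -> : d%:Z * (x * (m * e)%N%:Z + v) - (d < e)%N%:Z =
   (d%:Z * x * m%:Z) * e%:Z + (d%:Z * v - (d < e)%N%:Z).
  by rewrite PoszM; ring.
by rewrite divzMDl ?modzMDl //; lia.
Qed.

(** In order: the touching index, the floor there modulo m, and the pairs (e, v) to its right and to
    its left. *)
Definition word_code (k m : nat) : finType :=
  ('I_k * 'I_m * ('I_k * 'I_(m * k)) * ('I_k * 'I_(m * k)))%type.

Definition decode_word (k m : nat) (x : word_code k m) (i : nat) : nat :=
  let: (i1, r, evr, evl) := x in
  `|((r%:Z + (if (i < i1)%N then slope_word evl.1 evl.2 (i1 - i)
              else if (i1 < i)%N then slope_word evr.1 evr.2 (i - i1)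
              else 0)) %% m%:Z)%Z|%N.

Lemma card_word_code (k m : nat) : #|word_code k m| = (m ^ 3 * k ^ 5)%N.
Proof. by rewrite /word_code !card_prod !card_ord; ring. Qed.

(* Lowering g by its least fractional part keeps all floors and makes g pass
   through a lattice point at i1; both sides of i1 are then coded by
   slope_word_code. *)
Lemma almost_affine_word_code (R : realType) (g : nat -> R) (s : nat -> nat)
    (k m : nat) : (0 < k)%N -> (0 < m)%N ->
  (forall i, (i < k)%N -> (s i)%:R <= g i < (s i)%:R + 1) ->
  (forall x y z, (x < y)%N -> (y < z)%N -> (z < k)%N ->
     0 <= (y%:R - x%:R) * (g z - g y) - (z%:R - y%:R) * (g y - g x) <= 1) ->
  exists w : word_code k m, forall i, (i < k)%N -> (s i %% m)%N = decode_word w i.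
Proof.
move=> k0 m0 fl cross.
have [i1 i1min] : exists i1 : 'I_k, forall i : 'I_k,
    g i1 - (s i1)%:R <= g i - (s i)%:R.
  case: (arg_minP (P := xpredT) (fun i : 'I_k => g i - (s i)%:R)
    (i0 := Ordinal k0)) => // i1 _ h.
  by exists i1 => i; exact: h.
have min i : (i < k)%N -> g i1 - (s i1)%:R <= g i - (s i)%:R.
  by move=> ik; exact: (i1min (Ordinal ik)).
have i1k := ltn_ord i1.
have u_fl i : (i < k)%N ->
    ((s i)%:Z - (s i1)%:Z)%:~R <= g i - g i1 < ((s i)%:Z - (s i1)%:Z)%:~R + 1.
  move=> ik; rewrite intrB -!pmulrn.
  by have := fl i ik; have := fl i1 i1k; have := min i ik; lra.
have [|||evr hright] := @slope_word_code R (fun d => g (i1 + d)%N - g i1)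
    (fun d => (s (i1 + d)%N)%:Z - (s i1)%:Z) m k (k.-1 - i1) m0.
- by lia.
- by move=> d dD; apply: u_fl; lia.
- move=> d d' d0 dd' d'D.
  have x1 : (i1 < i1 + d)%N by lia.
  have x2 : (i1 + d < i1 + d')%N by lia.
  have x3 : (i1 + d' < k)%N by lia.
  by have := cross _ _ _ x1 x2 x3; rewrite !natrD; lra.
(* Reflection in [i1] preserves the cross inequality, so the left side is coded when read
   backwards. *)
have [||evl hleft] := @slope_word_code R (fun d => g (i1 - d)%N - g i1)
    (fun d => (s (i1 - d)%N)%:Z - (s i1)%:Z) m k i1 m0 i1k.
- by move=> d dD; apply: u_fl; lia.
- move=> d d' d0 dd' d'D.
  have x1 : (i1 - d' < i1 - d)%N by lia.
  have x2 : (i1 - d < i1)%N by lia.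
  by have := cross _ _ _ x1 x2 i1k; rewrite !natrB; [lra|lia|lia].
exists (i1, Ordinal (ltn_pmod (s i1) m0), evr, evl) => i ik /=.
apply/eqP; rewrite -eqz_nat -modz_nat gez0_abs; last first.
  by rewrite modz_ge0 //; lia.
rewrite -modz_nat modzDml.
have [lt|gt|->] := ltngtP i i1.
- have x1 : (0 < i1 - i <= i1)%N by lia.
  have := hleft _ x1; rewrite subKn 1?ltnW //.
  move/eqP; rewrite -(eqz_modDl (s i1)%:Z) => /eqP <-.
  by rewrite addrC subrK.
- have x1 : (0 < i - i1 <= k.-1 - i1)%N by lia.
  have := hright _ x1; rewrite subnKC 1?ltnW //.
  move/eqP; rewrite -(eqz_modDl (s i1)%:Z) => /eqP <-.
  by rewrite addrC subrK.
- by rewrite addr0.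
Qed.

(** * The two bounds on the complexity *)

Lemma subword_complexity_le (m k N : nat) (u : nat -> nat) (T : finType)
    (dec : T -> nat -> nat) : (0 < m)%N ->
  (forall n, (N <= n)%N -> exists t, forall i, (i < k)%N -> u (n + i)%N = dec t i) ->
  (subword_complexity m u k <= N + #|T|)%N.
Proof.
move=> m0 code.
pose w (f : nat -> nat) : {ffun 'I_k -> 'I_m} :=
  [ffun i : 'I_k => Ordinal (ltn_pmod (f i) m0)].
pose S1 := [set w (fun i => u (n + i)%N) | n : 'I_N].
pose S2 := [set w (dec t) | t : T].
apply: (@leq_trans #|S1 :|: S2|).
  apply/subset_leq_card/fintype.subsetP => B.
  rewrite !inE => -[n Bn].
  have Bw (f : nat -> nat) : (forall i, (i < k)%N -> u (n + i)%N = f i) -> B = w f.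
    move=> uf; apply/ffunP => i; apply/val_inj; rewrite ffunE /= -uf //.
    by rewrite -Bn modn_small //; exact: ltn_ord.
  have [nN|Nn] := ltnP n N.
    by apply/orP; left; apply/imsetP; exists (Ordinal nN) => //; exact: Bw.
  have [t ht] := code n Nn.
  by apply/orP; right; apply/imsetP; exists t => //; exact: Bw.
apply: leq_trans (leq_card_setU _ _) _; apply: leq_add.
  by apply: leq_trans (leq_imset_card _ _) _; rewrite card_ord.
exact: leq_imset_card.
Qed.

Lemma floor_powR_complexity_le (R : realType) (c : R) (m k : nat) :
  1 < c -> c < 2 -> (0 < m)%N -> (0 < k)%N ->
  (subword_complexity m (floor_pow_mod c m) k <=
    Num.truncn ((2 * k%:R ^+ 3 : R) `^ (2 - c)^-1) + 1 + m ^ 3 * k ^ 5)%N.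
Proof.
move=> c1 c2 m0 k0; rewrite -card_word_code addn1.
have kR : 0 < k%:R :> R by rewrite ltr0n.
have k3 : 0 < 2 * k%:R ^+ 3 :> R by rewrite mulr_gt0 ?exprn_gt0.
apply: subword_complexity_le => // n Nn.
have nX : (2 * k%:R ^+ 3) `^ (2 - c)^-1 <= n%:R.
  by rewrite ltW // (lt_le_trans (truncnS_gt _)) // ler_nat.
have n0 : 0 < n%:R :> R by apply: lt_le_trans nX; exact: powR_gt0.
(* The threshold on n is chosen for this: the cross term is at most 2 n^(c-2) k^3. *)
have small : n%:R `^ (c - 2) * (2 * k%:R ^+ 3) <= 1.
  rewrite -ler_pdivlMr // div1r.
  have -> : (2 * k%:R ^+ 3)^-1 = ((2 * k%:R ^+ 3) `^ (2 - c)^-1) `^ (c - 2).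
    rewrite -powRrM -[c - 2]opprB mulrN mulVf ?gt_eqF ?subr_gt0 //.
    by rewrite powR_inv1 // ltW.
  by apply: powR_npos_le => //; [lra | exact: powR_gt0].
apply: (@almost_affine_word_code R (fun i => (n + i)%:R `^ c)) => //
  [i _|x y z xy yz zk].
  by rewrite natr1; apply: truncn_itv; exact: powR_ge0.
have xyR : x%:R < y%:R :> R by rewrite ltr_nat.
have yzR : y%:R < z%:R :> R by rewrite ltr_nat.
have zkR : z%:R < k%:R :> R by rewrite ltr_nat.
have x0 : 0 <= x%:R :> R by [].
have := @powR_cross R c n%:R (n + x)%:R (n + y)%:R (n + z)%:R (ltW c1) (ltW c2) n0.
rewrite !natrD lerDl !lerD2l !(ltW xyR, ltW yzR) x0 => /(_ isT isT isT).
set F := n%:R `^ (c - 2) in small *.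
have F0 : 0 <= F by exact: powR_ge0.
have -> : n%:R + y%:R - (n%:R + x%:R) = y%:R - x%:R :> R by ring.
have -> : n%:R + z%:R - (n%:R + y%:R) = z%:R - y%:R :> R by ring.
have -> : n%:R + z%:R - (n%:R + x%:R) = z%:R - x%:R :> R by ring.
move=> /andP[-> h] /=; apply: le_trans h _; apply: le_trans small.
have -> : F * (2 * k%:R ^+ 3) = k%:R * k%:R * (2 * F * k%:R) by ring.
by rewrite !ler_pM ?mulr_ge0 ?subr_ge0 //; lra.
Qed.

Theorem theorem3 (R : realType) (c : R) (m : nat)
    (hc1 : 1 < c) (hc2 : c < 2) (hm : (2 <= m)%N) :
  (forall r : R, Num.max (4 / (2 - c)) 6 < r ->
     exists C1 : R, forall k : nat, (1 <= k)%N ->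
       ((subword_complexity m (floor_pow_mod c m) k)%:R : R) <= C1 * (k%:R `^ r))
  /\
  (exists C2 : R, 0 < C2 /\ forall k : nat, (1 <= k)%N ->
       C2 * (k%:R ^+ 3) <= ((subword_complexity m (floor_pow_mod c m) k)%:R : R)).
Proof.
have m0 : (0 < m)%N by exact: leq_trans hm.
have c20 : 0 < 2 - c by rewrite subr_gt0.
split=> [r|].
  rewrite gt_max => /andP[r4 r6].
  (* The summands serve the threshold, the extra 1 and the codes, whose exponents 3/(2-c), 0 and 5
     are all below r. *)
  exists (2 `^ (2 - c)^-1 + 1 + m%:R ^+ 3) => k k0.
  have kR : 1 <= k%:R :> R by rewrite ler1n.
  have := floor_powR_complexity_le hc1 hc2 m0 k0; rewrite -(ler_nat R).
  move=> /le_trans; apply; rewrite !natrD natrM !natrX.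
  rewrite [leRHS]mulrDl [in leRHS]mulrDl mul1r.
  apply: lerD; first apply: lerD.
  - apply: (@le_trans _ _ ((2 * k%:R ^+ 3) `^ (2 - c)^-1)).
      by rewrite truncn_le powR_ge0.
    rewrite powRM // ?exprn_ge0 // ler_wpM2l ?powR_ge0 //.
    rewrite -powR_mulrn // -powRrM ler_powR //.
    apply: le_trans (ltW r4); rewrite ler_wpM2r ?invr_ge0 ?ltW //; lra.
  - by rewrite -[leLHS](powRr0 k%:R) ler_powR //; lra.
  - rewrite ler_wpM2l ?exprn_ge0 // -powR_mulrn // ler_powR //; lra.
(* 1728 = 64 * 27, since k <= 3 * (k / 2) for k >= 2 *)
exists 1728^-1; split; first by rewrite invr_gt0.
move=> k k0; rewrite ler_pdivrMl // -natrX -natrM ler_nat.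
(* For k = 1 the half [k./2] is 0 and the totient sum gives nothing, so the existence of one word is
   used. *)
have [->|k2] : k = 1%N \/ (2 <= k)%N by lia.
  have um n : (floor_pow_mod c m n < m)%N by rewrite ltn_mod.
  by have := subword_complexity_gt0 1 um; lia.
have occ p q a : (p < q)%N -> exists n, forall i, (i < k)%N ->
    floor_pow_mod c m (n + i) = ((a + i * p) %/ q %% m)%N.
  exact: floor_powR_line_occurs.
have Kk : (2 * k./2 <= k)%N by lia.
have := subword_complexity_ge hm Kk occ; have := sum_mul_totient_ge k./2.
have : (k ^ 3 <= (3 * k./2) ^ 3)%N by rewrite leq_exp2r //; lia.
by rewrite expnMn; lia.
Qed.
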